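(* Let $X$ be a locally compact $\sigma$-compact topological space (not assumed to satisfy any separation axiom). Then $\tau_{cr} = \tau_q$ on $\gamma(X)$, and $\gamma(X)$ with this topology is paracompact.
   Context: A topological space $X$ is called locally compact if every point of $X$ has a neighbourhood base consisting of compact sets; neither ''compact'' nor ''locally compact'' includes the Hausdorff property. $X$ is $\sigma$-compact if it is a countable union of compact subsets. $C^b(X)$ denotes the algebra of all complex valued bounded continuous functions on $X$. Define an equivalence relation on $X$ by $x_1\sim x_2$ if $f(x_1)=f(x_2)$ for every $f\in C^b(X)$. Let $\gamma(X) := X/{\sim}$ and let $q: X\to\gamma(X)$ be the quotient map. $\tau_q$ denotes the quotient topology on $\gamma(X)$, and $\tau_{cr}$ denotes the weak topology on $\gamma(X)$ defined by the functions of $C^b(X)$ viewed as functions on $\gamma(X)$, i.e. the coarsest topology making all functions $\bar f:\gamma(X)\to\mathbb{C}$, $\bar f(q(x)) = f(x)$, $f\in C^b(X)$, continuous. *)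

(* Defs.v *)
From HB Require Import structures.
From mathcomp Require Import all_boot all_order all_algebra generic_quotient.
From mathcomp Require Import complex.
From mathcomp Require Import all_classical all_reals all_analysis.
Import Order.TTheory GRing.Theory Num.Theory.
Import numFieldNormedType.Exports.

Set Implicit Arguments.
Unset Strict Implicit.
Unset Printing Implicit Defensive.

Local Open Scope classical_set_scope.
Local Open Scope ring_scope.
Local Open Scope quotient_scope.

(* The library's [locally_compact] asks only for one compact *closed*
   neighbourhood of each point; without separation axioms this is neither
   stronger nor weaker than the notion below. *)
Definition locally_compact_space (X : topologicalType) : Prop :=
  forall (x : X) (U : set X), nbhs x U ->
    exists K : set X, [/\ nbhs x K, compact K & K `<=` U].

Definition sigma_compact_space (X : topologicalType) : Prop :=
  exists K : nat -> set X,
    (forall n, compact (K n)) /\ \bigcup_n K n = [set: X].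

Definition locally_finite (T : topologicalType) (V : set (set T)) : Prop :=
  forall x : T, exists2 N : set T, nbhs x N &
    finite_set [set B | V B /\ B `&` N !=set0].

(* As usual (Bourbaki, Engelking), paracompact spaces are Hausdorff. *)
Definition paracompact_space (T : topologicalType) : Prop :=
  hausdorff_space T /\
  forall U : set (set T),
    (forall A, U A -> open A) -> \bigcup_(A in U) A = [set: T] ->
    exists V : set (set T),
      [/\ forall B, V B -> open B,
          \bigcup_(B in V) B = [set: T],
          forall B, V B -> exists2 A, U A & B `<=` A
        & locally_finite V].

Section Gamma.
Variables (R : realType) (X : topologicalType).

(* [R[i]^o] is the type of complex numbers with the topology of the modulus. *)
Definition Cb : set (X -> R[i]^o) :=
  [set f | continuous f /\ bounded_fun f].

Definition Cb_eq (x1 x2 : X) : bool :=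
  `[< forall f, Cb f -> f x1 = f x2 >].

Lemma Cb_eq_refl : reflexive Cb_eq.
Proof. by move=> x; apply/asboolP. Qed.

Lemma Cb_eq_sym : symmetric Cb_eq.
Proof.
by move=> x y; apply/asboolP/asboolP => h f Cf; rewrite (h f Cf).
Qed.

Lemma Cb_eq_trans : transitive Cb_eq.
Proof.
move=> y x z /asboolP xy /asboolP yz; apply/asboolP => f Cf.
by rewrite (xy f Cf) (yz f Cf).
Qed.

Canonical Cb_equiv := EquivRel Cb_eq Cb_eq_refl Cb_eq_sym Cb_eq_trans.

Definition gamma := {eq_quot Cb_equiv}.

Definition gamma_q : topologicalType := quotient_topology gamma.

Definition Cb_bar (f : X -> R[i]^o) : gamma -> R[i]^o := fun y => f (repr y).

(* [Cb_bar f] is the function induced by [f] on the quotient. *)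
Lemma Cb_barE (f : X -> R[i]^o) (x : X) :
  Cb f -> Cb_bar f (\pi_gamma x) = f x.
Proof.
move=> Cf; have /eqP/eqmodP/asboolP h : repr (\pi_gamma x) == x %[mod gamma].
  by rewrite reprK.
exact: h.
Qed.

Definition gamma_cr : topologicalType :=
  sup_topology (fun f : Cb =>
    Topological.class (initial_topology (Cb_bar (val f)))).

Definition tau_q : set (set gamma) := @open gamma_q.

Definition tau_cr : set (set gamma) := @open gamma_cr.

End Gamma.

Arguments tau_q : clear implicits.
Arguments tau_cr : clear implicits.

(* Main.v *)
(* Write gamma for the quotient with its quotient topology. Functions in C^b(X)
   separate the points of gamma by disjoint closed neighbourhoods, and
   exhausting X by compact sets whose interiors cover X shows that gamma carries
   the weak topology of an increasing sequence of compact subsets, i.e. is a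
   Hausdorff k_omega-space. Such a space is normal, so Urysohn functions,
   pulled back to X, show that tau_cr is as fine as tau_q. Paracompactness
   follows from sigma-compactness by means of countably many Urysohn functions
   subordinate to a given open cover. *)
Require Import Defs.
From mathcomp Require Import all_boot all_order all_algebra.
From mathcomp Require Import generic_quotient complex.
From mathcomp Require Import all_classical all_reals all_analysis.
Import Order.TTheory GRing.Theory Num.Theory.
Import numFieldNormedType.Exports.

Set Implicit Arguments.
Unset Strict Implicit.
Unset Printing Implicit Defensive.

Local Open Scope classical_set_scope.
Local Open Scope ring_scope.
Local Open Scope quotient_scope.

(** * Disjoint closed neighbourhoods of compact sets, and normality *)

(** If [P K] failed, the sets [A] such that [P] holds for [K] minus [A] would form a proper filter
    containing [K]. At a cluster point in [K], a neighbourhood satisfying [P] would have to meet its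
    own complement, a member of that filter. *)
Lemma compact_induction (T : topologicalType) (K : set T)
    (P : set T -> Prop) :
  compact K -> P set0 -> (forall A B, A `<=` B -> P B -> P A) ->
  (forall A B, P A -> P B -> P (A `|` B)) ->
  (forall x, K x -> exists2 N, nbhs x N & P N) -> P K.
Proof.
move=> cK P0 Psub PU Ploc; apply: contrapT => nPK.
pose F : set_system T := [set A | P (K `\` A)].
have FF : Filter F.
  split; rewrite /F /=; first by rewrite setDT.
    by move=> A B PA PB /=; rewrite setDIr; exact: PU.
  by move=> A B AB; apply: Psub; exact: setDS.
have PF : ProperFilter F by split => //; rewrite /F /= setD0.
have [|x [Kx clx]] := cK F PF; first by rewrite /F /= setDv.
have [N xN PN] := Ploc x Kx.
have FN : F (~` N) by apply: Psub PN => y [_ /contrapT].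
by have [y []] := clx _ _ FN xN.
Qed.

(** The neighbourhoods are closed, not just open, so that their traces on the next compact set in
    [k_omega_normal] are closed again. *)
Definition closed_separated (T : topologicalType) (A B : set T) :=
  exists C E, [/\ closed C, closed E, A `<=` C°, B `<=` E° & C `&` E = set0].

Lemma closed_separated_sym (T : topologicalType) (A B : set T) :
  closed_separated A B -> closed_separated B A.
Proof.
by move=> [C [E [cC cE AC BE CE]]]; exists E, C; split; rewrite // setIC.
Qed.

Lemma closed_separated_preimage (T Z : topologicalType) (f : T -> Z)
    (A B : set Z) :
  continuous f -> closed_separated A B ->
  closed_separated (f @^-1` A) (f @^-1` B).
Proof.
move=> cf [C [E [cC cE AC BE CE]]]; exists (f @^-1` C), (f @^-1` E); split.
- exact: (continuous_closedP f).1.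
- exact: (continuous_closedP f).1.
- by move=> x /AC /cf.
- by move=> x /BE /cf.
- by rewrite -preimage_setI CE preimage_set0.
Qed.

Lemma hausdorff_uniform_closed_separated (T : uniformType) (x y : T) :
  hausdorff_space T -> x != y -> closed_separated [set x] [set y].
Proof.
rewrite open_hausdorff => hT /hT[[A B] /= []]; rewrite !inE.
move=> Ax By [oA oB AB].
have [C Cx CA] := uniform_regular (open_nbhs_nbhs (conj oA Ax)).
have [E Ey EB] := uniform_regular (open_nbhs_nbhs (conj oB By)).
exists (closure C), (closure E); split; [exact: closed_closure..| | |].
- by move=> _ ->; exact: filterS (@subset_closure _ C) Cx.
- by move=> _ ->; exact: filterS (@subset_closure _ E) Ey.
- by rewrite -subset0 => z [/CA Az /EB Bz]; rewrite -AB.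
Qed.

(** Two pieces of [K] are treated together by intersecting the neighbourhoods of [A] and uniting the
    others. *)
Lemma closed_separated_compactr (T : topologicalType) (A K : set T) :
  compact K -> (forall y, K y -> closed_separated A [set y]) ->
  closed_separated A K.
Proof.
move=> cK sepA; apply: (compact_induction (P := closed_separated A) cK)
  => [|B D BD|B D|y Ky].
- exists setT, set0; split => //; rewrite ?interiorT ?setI0 //.
  exact: closed0.
- move=> [C [E [cC cE AC DE CE]]]; exists C, E; split => //.
  exact: subset_trans DE.
- move=> [C [E [cC cE AC BE CE]]] [C' [E' [cC' cE' AC' DE' CE']]].
  exists (C `&` C'), (E `|` E'); split.
  + exact: closedI.
  + exact: closedU.
  + by rewrite interiorI => y Ay; split; [exact: AC|exact: AC'].
  + move=> y [/BE|/DE']; first exact: (interiorS (@subsetUl _ _ _)).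
    exact: (interiorS (@subsetUr _ _ _)).
  + rewrite setIUr [C `&` C']setIC -[_ `&` _ `&` E]setIA CE setI0 set0U.
    by rewrite [C' `&` C]setIC -setIA CE' setI0.
- have [C [E [cC cE AC yE CE]]] := sepA y Ky.
  (* The pair found for [y] serves all of [E°]. *)
  exists E°; first by apply: nbhs_interior; exact: yE.
  by exists C, E; split.
Qed.

Lemma closed_separated_compact (T : topologicalType) :
  (forall x y : T, x != y -> closed_separated [set x] [set y]) ->
  forall K L : set T, compact K -> compact L -> K `&` L = set0 ->
  closed_separated K L.
Proof.
move=> sepT K L cK cL KL.
apply: closed_separated_compactr => // y Ly; apply: closed_separated_sym.
apply: closed_separated_compactr => // x Kx; apply: sepT.
apply/eqP => yx; have : (K `&` L) x by split; rewrite // -yx.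
by rewrite KL.
Qed.

Lemma closed_separated_hausdorff (T : topologicalType) :
  (forall x y : T, x != y -> closed_separated [set x] [set y]) ->
  hausdorff_space T.
Proof.
move=> sepT x y clxy; apply: contrapT => /eqP/sepT[C [E [_ _ xC yE CE]]].
have [z [Cz Ez]] := clxy C E (xC x erefl) (yE y erefl).
by have : (C `&` E) z by []; rewrite CE.
Qed.

(* Disjoint closed subsets [P n] and [Q n] of [L n], containing [A `&` L n] and
   [B `&` L n] and such that [P n.+1] and [Q n.+1] are neighbourhoods of [P n]
   and [Q n] relative to [L n.+1], have open unions separating [A] from [B]; the
   pair [(P n, Q n)] is [s n] below. *)
Lemma k_omega_normal (R : realType) (T : topologicalType) (L : nat -> set T) :
  (forall x y : T, x != y -> closed_separated [set x] [set y]) ->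
  (forall n, compact (L n)) -> {homo L : m n / (m <= n)%N >-> m `<=` n} ->
  \bigcup_n L n = setT ->
  (forall P : set T, (forall n x, P x -> L n x ->
    \forall y \near x, L n y -> P y) -> open P) ->
  normal_space T.
Proof.
move=> sepT cL homL covL openL; apply/(@normal_openP R) => A B cA cB AB0.
have hT := closed_separated_hausdorff sepT.
have clL n : closed (L n) by exact: compact_closed.
pose good n (s : set T * set T) := [/\ closed s.1 /\ closed s.2,
  s.1 `<=` L n /\ s.2 `<=` L n, s.1 `&` s.2 = set0,
  A `&` L n `<=` s.1 & B `&` L n `<=` s.2].
pose next n (s t : set T * set T) :=
  (forall x, s.1 x -> \forall y \near x, L n y -> t.1 y) /\
  (forall x, s.2 x -> \forall y \near x, L n y -> t.2 y).
(* [good] is a premise under the existential so that [choice] yields a total [f]; pairs that are not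
   good get an arbitrary value. *)
have step (ns : nat * (set T * set T)) : exists t, good ns.1 ns.2 ->
    good ns.1.+1 t /\ next ns.1.+1 ns.2 t.
  case: ns => n [P Q] /=.
  have [gPQ|] := pselect (good n (P, Q)); last by exists (P, Q).
  case: gPQ => -[/= cP cQ] [PL QL] PQ AP BQ.
  have LS : L n `<=` L n.+1 by exact: homL.
  have [|||C [E [cC cE AC BE CE]]] := closed_separated_compact sepT
    (K := P `|` (A `&` L n.+1)) (L := Q `|` (B `&` L n.+1)).
  - apply: (subclosed_compact _ (cL n.+1)).
      by apply: closedU => //; exact: closedI.
    by move=> x [/PL/LS|[]].
  - apply: (subclosed_compact _ (cL n.+1)).
      by apply: closedU => //; exact: closedI.
    by move=> x [/QL/LS|[]].
  (* A point of [A] in [Q] lies in [L n], hence in [P] by [AP], against [PQ]; likewise for [B] and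
     [P]. *)
  - rewrite -subset0 => x [[Px|[Ax _]] [Qx|[Bx _]]].
    + by rewrite -PQ.
    + by rewrite -PQ; split => //; apply: BQ; split => //; exact: PL.
    + by rewrite -PQ; split => //; apply: AP; split => //; exact: QL.
    + by rewrite -AB0.
  exists (C `&` L n.+1, E `&` L n.+1) => _; split.
    split => /=.
    + by split; exact: closedI.
    + by split; exact: subIsetr.
    + by rewrite setIACA CE set0I.
    + move=> x ALx; split; last by case: ALx.
      by apply: interior_subset; apply: AC; right.
    + move=> x BLx; split; last by case: BLx.
      by apply: interior_subset; apply: BE; right.
  split => x /= sx.
    have : nbhs x C by apply: AC; left.
    by apply: filterS => y.
  have : nbhs x E by apply: BE; left.
  by apply: filterS => y.
have [f fP] := choice step.
pose s := fix s n :=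
  if n is m.+1 then f (m, s m) else (A `&` L 0%N, B `&` L 0%N).
have goods n : good n (s n).
  elim: n => [|n IH]; last by have [] := fP (n, s n) IH.
  split => //=; last by rewrite setIACA AB0 set0I.
  by split; exact: closedI.
have nexts n : next n.+1 (s n) (s n.+1) by have [] := fP (n, s n) (goods n).
have subL n : (s n).1 `<=` L n /\ (s n).2 `<=` L n by have [] := goods n.
have homs (p : set T * set T -> set T) :
    (forall n x, p (s n) x -> \forall y \near x, L n.+1 y -> p (s n.+1) y) ->
    (forall n, p (s n) `<=` L n) ->
    {homo (p \o s) : m n / (m <= n)%N >-> m `<=` n}.
  move=> nbp pL; apply: homo_leq => [?//|? ? ?|n y py].
    exact: subset_trans.
  by apply: (nbhs_singleton (nbp n y py)); apply: (homL n) => //; exact: pL.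
have open_union (p : set T * set T -> set T) :
    (forall n x, p (s n) x -> \forall y \near x, L n.+1 y -> p (s n.+1) y) ->
    (forall n, p (s n) `<=` L n) -> open (\bigcup_n p (s n)).
  move=> nbp pL; apply: openL => k x [m _ pmx] Lkx.
  (* Passing to the index [m + k] makes [L k] part of [L (m + k).+1], where the relative
     neighbourhood is known. *)
  have pmkx := homs p nbp pL m (m + k)%N (leq_addr _ _) x pmx.
  have := nbp _ _ pmkx; apply: filterS => y py Lky.
  exists (m + k).+1 => //; apply: py.
  by apply: homL Lky; rewrite leqW// leq_addl.
have nb1 n x : (s n).1 x -> \forall y \near x, L n.+1 y -> (s n.+1).1 y.
  by have [+ _] := nexts n; exact.
have nb2 n x : (s n).2 x -> \forall y \near x, L n.+1 y -> (s n.+1).2 y.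
  by have [_ +] := nexts n; exact.
have sub1 n := (subL n).1; have sub2 n := (subL n).2.
exists (\bigcup_n (s n).1), (\bigcup_n (s n).2); split.
- exact: (open_union fst).
- exact: (open_union snd).
- move=> x Ax; have : (\bigcup_n L n) x by rewrite covL.
  by move=> [n _ Lx]; exists n => //; case: (goods n) => _ _ _ + _; apply.
- move=> x Bx; have : (\bigcup_n L n) x by rewrite covL.
  by move=> [n _ Lx]; exists n => //; case: (goods n) => _ _ _ _; apply.
- rewrite -subset0 => x [[m _ px] [n _ qx]].
  have [_ _ <- _ _] := goods (m + n)%N; split.
    exact: (homs fst nb1 sub1 m (m + n)%N (leq_addr _ _) x px).
  exact: (homs snd nb2 sub2 n (m + n)%N (leq_addl _ _) x qx).
Qed.

(** * Compact exhaustion *)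

(** Compactness puts each [S n] inside the interior of a finite union of compact neighbourhoods;
    partial unions of these make the sequence increasing. *)
Lemma compact_exhaustion (X : topologicalType) :
  locally_compact_space X -> sigma_compact_space X ->
  exists K : nat -> set X, [/\ forall n, compact (K n),
    {homo K : m n / (m <= n)%N >-> m `<=` n} & \bigcup_n (K n)° = setT].
Proof.
move=> lcX [S [cS covS]].
have /choice[C CP] n : exists C : set X, compact C /\ S n `<=` C°.
  apply: (compact_induction
    (P := fun B => exists C : set X, compact C /\ B `<=` C°) (cS n)).
  - by exists set0; split => //; exact: compact0.
  - by move=> A B AB [C [cC BC]]; exists C; split => //; exact: subset_trans BC.
  - move=> A B [C [cC AC]] [D [cD BD]]; exists (C `|` D); split.
      exact: compactU.
    move=> y [/AC|/BD]; first exact: (interiorS (@subsetUl _ _ _)).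
    exact: (interiorS (@subsetUr _ _ _)).
  - move=> x _; have [C [xC cC _]] := lcX x setT filterT.
    exists C°; first exact: nbhs_interior.
    by exists C; split.
(* The bound [n.+1] makes the [n]-th union include [C n]. *)
exists (fun n => \big[setU/set0]_(i < n.+1) C i); split.
- by move=> n; apply: bigsetU_compact => i _; case: (CP i).
- by move=> m n mn; exact: subset_bigsetU.
- rewrite -subTset => x _; have : (\bigcup_n S n) x by rewrite covS.
  move=> [n _ Sx]; exists n => //; apply: (interiorS (A := C n)).
    exact: bigsetU_sup.
  by case: (CP n) => _; apply.
Qed.

(** * Urysohn functions and paracompactness *)

(** Complete regularity without the Hausdorff axiom; both conclusions of the theorem use Urysohn
    functions in this form. *)
Definition point_function_separated (R : realType) (T : topologicalType) :=
  forall (x : T) (A : set T), open A -> A x -> exists f : T -> R,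
    [/\ continuous f, forall y, 0 <= f y <= 1, f x = 1 &
        forall y, ~ A y -> f y = 0].

Lemma normal_point_function_separated (R : realType) (T : topologicalType) :
  hausdorff_space T -> normal_space T -> point_function_separated R T.
Proof.
move=> hT nT x A oA Ax.
have [|||| f [cf f0 f1 f01]] := @urysohn_ext_itv _ R nT (~` A) [set x] 0 1.
- exact: open_closedC.
- exact/accessible_closed_set1/hausdorff_accessible.
- by rewrite -subset0 => y [nAy yx]; apply: nAy; rewrite yx.
- exact: ltr01.
exists f; split => //.
- by move=> y; have := f01 (f y); rewrite /= in_itv /=; apply; exists y.
- by apply: f1; exists x.
- by move=> y nAy; apply: f0; exists y.
Qed.

Lemma sigma_compact_paracompact (R : realType) (T : topologicalType)
    (L : nat -> set T) :
  hausdorff_space T -> point_function_separated R T ->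
  (forall n, compact (L n)) -> \bigcup_n L n = setT -> paracompact_space T.
Proof.
move=> hT sepT cL covL; split => // U oU covU.
(* Asking for [A] only when the function is positive somewhere lets the zero function serve as
   padding, even for empty [U]. *)
pose subord (f : T -> R) := [/\ continuous f, forall y, 0 <= f y &
  [set y | 0 < f y] !=set0 ->
    exists2 A, U A & [set y | 0 < f y] `<=` A].
have sub0 : subord (fun=> 0).
  split => //; first by move=> x; exact: cvg_cst.
  by move=> [x]; rewrite /= ltxx.
pose covered (B : set T) := exists g : nat -> T -> R,
  (forall n, subord (g n)) /\ B `<=` \bigcup_n [set y | 0 < g n y].
have covered_bigcup (B : nat -> set T) :
    (forall n, covered (B n)) -> covered (\bigcup_n B n).
  move=> /choice[g gP].
  (* Pairs are enumerated through [pickle]; codes of no pair get the zero function. *)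
  exists (fun k => if unpickle k is Some (n, m) then g n m else fun=> 0).
  split=> [k|y [n _ /(gP n).2[m _ /= gy]]].
    by case: (unpickle k) => [[n m]|//]; exact: (gP n).1.
  by exists (pickle (n, m)) => //=; rewrite pickleK.
have [g [gU gcov]] : covered setT.
  rewrite -covL; apply: (covered_bigcup) => n.
  apply: (compact_induction (P := covered) (cL n)).
  - by exists (fun _ _ => 0); split.
  - move=> A B AB [g [gU gB]]; exists g; split => //.
    exact: subset_trans gB.
  - move=> A B cA cB; rewrite -bigcup2E; apply: covered_bigcup => -[|[|i]] //=.
    by exists (fun _ _ => 0); split.
  - move=> x _; have : (\bigcup_(A in U) A) x by rewrite covU.
    move=> [A UA Ax]; have [f [cf f01 fx fA]] := sepT x A (oU A UA) Ax.
    exists [set y | 0 < f y].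
      apply: open_nbhs_nbhs; split; last by rewrite /= fx.
      by apply: (open_comp (f := f) (D := [set r | 0 < r])).
    exists (fun=> f); split; last by move=> y fy; exists 0%N.
    move=> _; split => //; first by move=> y; case/andP: (f01 y).
    move=> _; exists A => // y /= fy; apply: contrapT => /fA fy0.
    by move: fy; rewrite fy0 ltxx.
have g0 n y : 0 <= g n y by case: (gU n).
have cg n : continuous (g n) by case: (gU n).
(* [V n] meets [g k > c] only if [n <= k] or [n * c < 1]; this gives local
   finiteness. For the least [n] with [g n y > 0], [V n] contains [y]. *)
pose V n := [set y | 0 < g n y /\ n%:R * \sum_(i < n) g i y < 1].
(* Empty [V n] are discarded because [subord] provides a member of [U] only for a function that is
   positive somewhere. *)
exists [set B | B !=set0 /\ exists n, B = V n]; split.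
- move=> _ [_ [n ->]]; apply: openI.
    by apply: (open_comp (f := g n) (D := [set r | 0 < r])).
  apply: (open_comp (f := fun y => n%:R * \sum_(i < n) g i y)
    (D := [set r | r < 1])); last exact: open_lt.
  move=> y _; apply: cvgM; first exact: cvg_cst.
  by apply: (continuous_big (@add_continuous R)) => i _; exact: cg.
- rewrite -subTset => y _.
  have exg : exists n, 0 < g n y by have [n _] := gcov y I; exists n.
  have [n gn nmin] := ex_minnP exg.
  have Vy : V n y.
    split => //; rewrite big1 ?mulr0 // => i _; apply/eqP.
    rewrite eq_le g0 andbT leNgt; apply/negP => /nmin.
    by rewrite leqNgt ltn_ord.
  by exists (V n) => //; split; [exists y|exists n].
- move=> B [+ [n BV]]; rewrite {}BV => -[y Vy]; have [_ _ gA] := gU n.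
  have [|A UA gsub] := gA; first by exists y; case: Vy.
  by exists A => // z [/gsub].
- move=> x; have [k _ /= gk] := gcov x I.
  exists [set y | g k x / 2 < g k y].
    apply: open_nbhs_nbhs; split; last first.
      by rewrite /= ltr_pdivrMr // ltr_pMr // ltr1n.
    by apply: (open_comp (f := g k) (D := [set r | g k x / 2 < r])).
  (* With [c = g k x / 2], this [N] bounds every [n] such that [n <= k] or [n * c < 1]. *)
  pose N := maxn k (Num.truncn (2 / g k x)).
  apply: (@sub_finite_set _ _ (V @` `I_N.+1)); last first.
    exact/finite_image/finite_II.
  move=> B [[_ [n BV]]]; rewrite {}BV => -[y [[_ sum1] /= gky]].
  exists n => //=.
  rewrite ltnNge; apply/negP; rewrite gtn_max => /andP[kn trn].
  have : 2 / g k x < n%:R.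
    by rewrite -truncn_lt_nat // ltW // divr_gt0.
  rewrite ltr_pdivrMr // => ngk; move: sum1; apply/negP; rewrite -leNgt.
  (* For [n] beyond both bounds, the single term [g k y > c] already makes the product at least
     [1]. *)
  rewrite (bigD1 (Ordinal kn)) //=.
  have s0 : 0 <= \sum_(i < n | i != Ordinal kn) g i y by exact: sumr_ge0.
  apply: (@le_trans _ _ (n%:R * (g k x / 2))).
    by rewrite mulrA ler_pdivlMr // mul1r ltW.
  by rewrite ler_wpM2l // ler_wpDr // ltW.
Qed.

(** * The two topologies on gamma *)

Lemma norm_real_complex (R : rcfType) (r : R) : `|r%:C%C| = `|r|%:C%C.
Proof. by rewrite normc_def /= expr0n addr0 sqrtr_sqr. Qed.

Lemma real_complex_continuous (R : realType) :
  continuous ((fun r => r%:C%C) : R -> R[i]^o).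
Proof.
move=> x; apply/cvgrPdist_lt => e e0.
(* In the order on complex numbers, [0 < e] forces [e] to be real. *)
have [e1 e2] : 0 < complex.Re e /\ e = (complex.Re e)%:C%C.
  by case: e e0 => a b; rewrite ltcE /= => /andP[/eqP -> ->].
near=> t; rewrite -rmorphB norm_real_complex e2 ltcR.
by near: t; exact: cvgr_dist_lt.
Unshelve. all: end_near.
Qed.

Section GammaSpace.
Variables (R : realType) (X : topologicalType).
Local Notation T := (gamma_q R X).
Local Notation q := (\pi_(gamma R X) : X -> T).

Lemma Cb_bar_continuous (f : X -> R[i]^o) :
  Cb f -> continuous (Cb_bar f : T -> R[i]^o).
Proof.
move=> Cf; apply/quotient_continuous.
have -> : Cb_bar f \o \pi_T = f by apply/funext => x; exact: Cb_barE.
by case: Cf.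
Qed.

(** Distinct classes are told apart by some [f] in [Cb]; disjoint closed neighbourhoods of the two
    values pull back along [Cb_bar f]. *)
Lemma gamma_q_separated (x y : T) :
  x != y -> closed_separated [set x] [set y].
Proof.
move=> xy; have [f Cf fxy] : exists2 f, Cb f & Cb_bar f x != Cb_bar f y.
  apply: contrapT => h; case/negP: xy.
  rewrite -[x]reprK -[y]reprK; apply/eqP/eqmodP/asboolP => f Cf.
  by apply: contrapT => /eqP fxy; apply: h; exists f.
have [C [E [cC cE fC fE CE]]] := closed_separated_preimage
  (Cb_bar_continuous Cf)
  (hausdorff_uniform_closed_separated (@norm_hausdorff _ R[i]^o) fxy).
by exists C, E; split => // _ ->; [exact: fC|exact: fE].
Qed.

(** Gives the inclusion of [tau_cr] in [tau_q]: every induced function is continuous on the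
    quotient. *)
Lemma gamma_cr_continuous_id : continuous (id : T -> gamma_cr R X).
Proof.
move=> x; apply: (cvg_sup _ _ (fmap_filter _ (nbhs_filter x))).2 => -[f Cf].
apply: (@continuous_comp_initial _ _ _ _
  (id : T -> initial_topology (Cb_bar f))).
by apply: Cb_bar_continuous; exact: set_mem.
Qed.

Lemma Cb_real (h : T -> R) : continuous h -> (forall y, 0 <= h y <= 1) ->
  Cb ((fun x => (h (q x))%:C%C) : X -> R[i]^o).
Proof.
move=> ch h01; split.
  move=> x; apply: (@continuous_comp _ _ _ (h \o q)
    (fun r => r%:C%C : R[i]^o)); last exact: real_complex_continuous.
  by apply: continuous_comp; [exact: pi_continuous|exact: ch].
exists 1; split; first exact: real1.
move=> M M1 x _ /=; rewrite norm_real_complex (le_trans _ (ltW M1)) //.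
by rewrite lecR; have /andP[h0 h1] := h01 (q x); rewrite ger0_norm.
Qed.

Lemma tau_cr_eq_tau_q : point_function_separated R T -> tau_cr R X = tau_q R X.
Proof.
move=> sepT; apply/seteqP; split => A oA.
  rewrite /tau_q openE => y Ay; apply: gamma_cr_continuous_id.
  exact: open_nbhs_nbhs.
rewrite /tau_cr openE => y Ay.
have [h [ch h01 hy hA]] := sepT y A oA Ay.
have Cf := Cb_real ch h01; set f := (X in Cb X) in Cf.
have fE z : Cb_bar f z = (h z)%:C%C by rewrite -[z in RHS]reprK.
(* Neighbourhoods of [y] for the single function [Cb_bar f] are neighbourhoods for [tau_cr]; the one
   used is where [Cb_bar f] is nonzero, which lies in [A]. *)
have /cvg_sup/(_ (exist _ f (mem_set Cf))) :
  nbhs (y : gamma_cr R X) --> (y : gamma_cr R X) by [].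
apply; apply: (@filterS _ _ (nbhs_filter (y : initial_topology (Cb_bar f)))
  (Cb_bar f @^-1` (~` [set 0]))).
  move=> z /= fz; apply: contrapT => /hA hz; apply: fz.
  by rewrite fE hz.
apply: (@open_nbhs_nbhs (initial_topology (Cb_bar f))).
split; last by rewrite /= fE hy; apply/eqP/oner_neq0.
exists (~` [set 0]) => //; rewrite openC.
exact/accessible_closed_set1/hausdorff_accessible/norm_hausdorff.
Qed.

(** Openness is tested in [X]: a point lies in the interior of some [K n], and nearby points map
    into the image of [K n], so the relative condition there becomes an ordinary one. *)
Lemma gamma_q_weak (K : nat -> set X) (P : set T) :
  \bigcup_n (K n)° = setT ->
  (forall n x, P x -> (q @` K n) x ->
    \forall y \near x, (q @` K n) y -> P y) -> open P.
Proof.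
move=> covK nbP; rewrite /open /= /quotient_open openE => x /= Px.
have : (\bigcup_n (K n)°) x by rewrite covK.
move=> [n _ Kx]; have Kqx : (q @` K n) (q x).
  by exists x => //; exact: interior_subset.
have /pi_continuous := nbP n (q x) Px Kqx.
move=> h; near=> y.
  have : (q @` K n) (q y) -> P (q y) by near: y; exact: h.
  by apply; exists y => //; near: y.
Unshelve. all: end_near.
Qed.
End GammaSpace.

Theorem theorem2p6 (R : realType) (X : topologicalType) :
  locally_compact_space X -> sigma_compact_space X ->
  tau_cr R X = tau_q R X /\ paracompact_space (gamma_q R X).
Proof.
move=> lcX scX; have [K [cK homK covK]] := compact_exhaustion lcX scX.
pose L n : set (gamma_q R X) := \pi_(gamma R X) @` K n.
have cL n : compact (L n).
  apply: continuous_compact => //; apply: continuous_subspaceT.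
  exact: pi_continuous.
have homL : {homo L : m n / (m <= n)%N >-> m `<=` n}.
  by move=> m n mn; exact/image_subset/homK.
have covL : \bigcup_n L n = setT.
  rewrite -subTset => y _; have : (\bigcup_n (K n)°) (repr y) by rewrite covK.
  move=> [n _ Kx]; exists n => //; exists (repr y); last by rewrite reprK.
  exact: interior_subset.
have hT := closed_separated_hausdorff (@gamma_q_separated R X).
have nT : normal_space (gamma_q R X).
  apply: (k_omega_normal R (@gamma_q_separated R X) cL homL covL) => P.
  exact: gamma_q_weak.
have sepT := normal_point_function_separated R hT nT.
split; first exact: tau_cr_eq_tau_q.
exact: sigma_compact_paracompact hT sepT cL covL.
Qed.
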